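(* Let $1\le\alpha<2$ be a constant. Then there is a constant $C_\alpha$ such that every simple $n$-vertex graph $G$ satisfies $\mathrm{cdim}_\alpha(G)\le C_\alpha n$, i.e. $\mathrm{cdim}_\alpha(G)=O(n)$.
   Context: A simple graph is an unweighted graph $G=(V,E)$ (every edge has weight $1$). For $\emptyset\ne X\subsetneq V$, $\Delta(X)$ is the set of edges with exactly one endpoint in $X$, and its weight is $|\Delta(X)|$; $\lambda$ is the minimum cut weight. For $\alpha\ge1$, an $\alpha$-near-mincut is a cut of weight at most $\alpha\lambda$, and $\mathcal{M}_\alpha(G)$ is the set of $\alpha$-near-mincuts. $\chi(S)\in\{0,1\}^{|E|}$ is the characteristic vector of $S\subseteq E$, and $\mathrm{cdim}_\alpha(G)=\dim\,\mathrm{span}\{\chi(S):S\in\mathcal{M}_\alpha(G)\}$. *)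

(* Defs.v *)
From mathcomp Require Import all_boot all_order all_algebra.
From mathcomp Require Import reals.
Set Implicit Arguments. Unset Strict Implicit. Unset Printing Implicit Defensive.
Import Order.TTheory GRing.Theory Num.Theory.
Local Open Scope ring_scope.

(* A simple graph: vertex set T (a finType), adjacency e : rel T that is
   symmetric and irreflexive. Edges are the 2-element vertex sets {x,y}
   with e x y. *)
Section Cuts.
Variables (T : finType) (e : rel T).

Definition edges : {set {set T}} :=
  [set s : {set T} | [exists x, exists y, e x y && (s == [set x; y])]].

Definition cut (X : {set T}) : {set {set T}} :=
  [set s in edges | #|s :&: X| == 1%N].

Definition proper_nonempty (X : {set T}) : bool := (X != set0) && (X != setT).

(* minimum cut weight lambda (equals #|edges| = 0 when there is no cut, n <= 1) *)
Definition mincut : nat :=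
  \big[minn/#|edges|]_(X : {set T} | proper_nonempty X) #|cut X|.

Variable R : realType.

Definition near_mincuts (alpha : R) : {set {set {set T}}} :=
  [set S | [exists X : {set T}, proper_nonempty X && (S == cut X)]
           && ((#|S|%:R : R) <= alpha * (mincut%:R))].

Definition near_mincut_matrix (alpha : R) :
  'M[R]_(#|near_mincuts alpha|, #|edges|) :=
  \matrix_(i < #|near_mincuts alpha|, j < #|edges|)
     ((enum_val j \in enum_val i : bool)%:R).

(* cdim_alpha(G) = dim span {chi(S) : S in M_alpha(G)} = rank of that matrix *)
Definition cdim (alpha : R) : nat := \rank (near_mincut_matrix alpha).

End Cuts.

(* Main.v *)
Require Import Defs.
From mathcomp Require Import all_boot all_order all_algebra.
From mathcomp Require Import reals.
From mathcomp Require sequences exp.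
From mathcomp Require Import zify ring lra.
Import Order.TTheory GRing.Theory Num.Theory.
Local Open Scope ring_scope.

(** Let every vertex pick two random incident edges (with repetition) and
    contract the picked edges, as in the random 2-out contraction of Ghaffari,
    Nowicki and Thorup. With minimum cut weight [lam], every degree is at least
    [lam], and exploring the component of a vertex pick by pick shows that it has
    at most [lam / 4] vertices with probability at most [2 / lam]; so the expected
    number of components is at most [6 n / lam]. On the other hand, in a cut of
    weight at most [alpha * lam] with at least two vertices on both sides, every
    vertex sends at most a fraction [alpha / 2 < 1] of its edges across, whence
    the cut survives the contraction with probability bounded below. The edges in
    surviving cuts number at most [alpha * lam] per component, since the indicator
    vectors of the surviving sets span a space whose dimension is at most the
    number of components. Taking expectations, only [O(n)] edges lie in such cuts,
    and the remaining cuts are the [n] stars. *)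

(** * Expectations under product measures on functions *)

Section Expectation.
Set Implicit Arguments. Unset Strict Implicit.
Variables (R : realFieldType) (I T : finType).
Implicit Types (mu : I -> T -> R) (f : {ffun I -> T}) (F G : {ffun I -> T} -> R).

Definition expect mu F : R := \sum_(f : {ffun I -> T}) (\prod_x mu x (f x)) * F f.

(** Conditioning on [f x = w] puts a point mass at coordinate [x], so the conditional law is again a
    product and [expect] applies to it. *)
Definition fix_at mu x w : I -> T -> R :=
  fun y u => if y == x then (u == w)%:R else mu y u.

Lemma expect_fix mu x F :
  expect mu F = \sum_w mu x w * expect (fix_at mu x w) F.
Proof.
rewrite /expect; under [RHS]eq_bigr do rewrite big_distrr /=.
rewrite exchange_big /=; apply: eq_bigr => f _.
rewrite [RHS](bigD1 (f x)) //= [X in _ + X]big1 ?addr0 => [|w wfx].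
  rewrite (bigD1 x) //= [in RHS](bigD1 x) //= {1}/fix_at !eqxx mul1r !mulrA.
  by congr (_ * _ * _); apply: eq_bigr => y yx; rewrite /fix_at (negbTE yx).
by rewrite (bigD1 x) //= {1}/fix_at eqxx eq_sym (negbTE wfx) !mul0r mulr0.
Qed.

Lemma expect_prod mu (g : I -> T -> R) :
  expect mu (fun f => \prod_x g x (f x)) = \prod_x \sum_u mu x u * g x u.
Proof.
by rewrite bigA_distr_bigA; apply: eq_bigr => f _; rewrite big_split.
Qed.

Lemma expect_cst mu (c : R) :
  (forall x, \sum_u mu x u = 1) -> expect mu (fun=> c) = c.
Proof.
move=> mu1; rewrite /expect -big_distrl /= -(bigA_distr_bigA mu).
by rewrite big1 ?mul1r.
Qed.

Lemma expect_sum mu (J : finType) (P : pred J) (F : J -> {ffun I -> T} -> R) :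
  expect mu (fun f => \sum_(j | P j) F j f) = \sum_(j | P j) expect mu (F j).
Proof.
by rewrite exchange_big; apply: eq_bigr => f _; rewrite big_distrr.
Qed.

Lemma expectZ mu c F : expect mu (fun f => c * F f) = c * expect mu F.
Proof. by rewrite /expect big_distrr; apply: eq_bigr => f _; rewrite mulrCA. Qed.

Lemma expectD mu F G :
  expect mu (fun f => F f + G f) = expect mu F + expect mu G.
Proof.
by rewrite /expect -big_split; apply: eq_bigr => f _; rewrite mulrDr.
Qed.

Lemma le_expect mu F G : (forall x u, 0 <= mu x u) ->
  (forall f, (forall x, mu x (f x) != 0) -> F f <= G f) ->
  expect mu F <= expect mu G.
Proof.
move=> mu0 FG; apply: ler_sum => f _.
have [/forallP nz|] := boolP [forall x, mu x (f x) != 0].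
  by rewrite ler_wpM2l ?prodr_ge0 ?FG.
by rewrite negb_forall => /existsP[x /negPn/eqP x0]; rewrite (bigD1 x) //= x0 !mul0r.
Qed.

End Expectation.

(** * The random contraction and its expected number of components *)

Section RandomContraction.
Set Implicit Arguments. Unset Strict Implicit.
Variables (R : realFieldType) (T : finType) (e : rel T).
Implicit Types (f : {ffun T * bool -> T}) (u v w : T).

Definition deg v : nat := #|[set u | e v u]|.

(** The two picks of [u] are indexed by [bool]; a picked edge is contracted whichever endpoint
    picked it. *)
Definition pick_rel f : rel T :=
  [rel u w | [exists b, (f (u, b) == w) || (f (w, b) == u)]].

Definition component f v : {set T} := [set w | connect (pick_rel f) v w].

Lemma pick_relE f u b : pick_rel f u (f (u, b)).
Proof. by apply/existsP; exists b; rewrite eqxx. Qed.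

Lemma pick_connect_sym f : connect_sym (pick_rel f).
Proof.
by apply: sym_connect_sym => u w; apply/eq_existsb => b; rewrite orbC.
Qed.

Definition ncomponents f : nat := #|[set v | roots (pick_rel f) v]|.

Definition small (lam : nat) f v : bool := (4 * #|component f v| <= lam)%N.

(** Components are counted by their roots. Those with more than [lam / 4] vertices number at most
    [4 * #|T| / lam], being disjoint; any other has a root that is itself counted by [small]. *)
Lemma ncomponents_bound lam f :
  (lam * ncomponents f <= 4 * #|T| + lam * \sum_v small lam f v)%N.
Proof.
rewrite mulnC /ncomponents -sum_nat_const.
have -> : (4 * #|T| = \sum_(v in [set v | roots (pick_rel f) v]) 4 * #|component f v|)%N.
  rewrite -big_distrr /=; congr (4 * _)%N.
  under eq_bigr do rewrite -sum1_card big_mkcond /=.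
  rewrite exchange_big /= -sum1_card; apply: eq_bigr => w _.
  rewrite (bigD1 (fingraph.root (pick_rel f) w)) /=; last first.
    by rewrite inE roots_root //; apply: pick_connect_sym.
  rewrite inE pick_connect_sym connect_root big1 ?addn0 // => v.
  rewrite !inE => /andP[/eqP rv vw]; case: ifP => // /(fingraph.rootP (@pick_connect_sym f)).
  by rewrite rv => vE; rewrite vE eqxx in vw.
rewrite big_distrr /= [X in (_ <= _ + X)%N](bigID [pred v | roots (pick_rel f) v]) /=.
under [X in (_ <= X + _)%N]eq_bigl do rewrite inE.
under [X in (X <= _)%N]eq_bigl do rewrite inE.
rewrite addnA; apply: leq_trans (leq_addr _ _); rewrite -big_split /=.
apply: leq_sum => v _; rewrite /small.
by case: (leqP (4 * _) lam) => [_|/ltnW h]; rewrite ?muln1 ?leq_addl // muln0 addn0.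
Qed.

(** * Exploration of one component, pick by pick *)

Variables (lam : nat) (lam_gt0 : (0 < lam)%N) (lam_deg : forall v, (lam <= deg v)%N).

Definition walk (x : T * bool) u : R := (e x.1 u)%:R / (deg x.1)%:R.

Lemma walk_ge0 x u : 0 <= walk x u.
Proof. by rewrite divr_ge0. Qed.

Lemma deg_gt0 v : 0 < (deg v)%:R :> R.
Proof. by rewrite ltr0n; apply: leq_trans (lam_deg v). Qed.

Lemma sum_walk x : \sum_u walk x u = 1.
Proof.
rewrite -big_distrl /= -natr_sum -(big_mkcond (fun u => e x.1 u)) sum1_card.
by rewrite /deg cardsE divff // -cardsE gt_eqF ?deg_gt0.
Qed.

(* In the course of exploring the component of [v], the picks in [D] have been
   revealed; they were made by vertices of [C], all known to lie in the
   component. *)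
Record explored (mu : T * bool -> T -> R) (D : {set T * bool}) (C : {set T}) v := {
  explored_ge0 : forall x u, 0 <= mu x u;
  explored_sum1 : forall x, \sum_u mu x u = 1;
  explored_walk : forall x, x \notin D -> mu x =1 walk x;
  explored_sub : D \subset setX C setT;
  explored_component :
    forall f, (forall x, mu x (f x) != 0) -> C \subset component f v }.

Lemma fix_at_explored mu D C v x w : explored mu D C v ->
  x.1 \in C -> x \notin D -> mu x w != 0 ->
  explored (fix_at mu x w) (x |: D) (w |: C) v.
Proof.
move=> [mu0 mu1 muw DC Cv] xC xD nz; split => [y u|y|y||f nzf].
- by rewrite /fix_at; case: ifP.
- rewrite /fix_at; case: eqP => // _.
  by rewrite (bigD1 w) //= eqxx big1 ?addr0 // => u /negbTE->.
- rewrite !inE negb_or => /andP[yx yD] u.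
  by rewrite /fix_at (negbTE yx) muw.
- apply/subsetP => -[y b]; rewrite !inE andbT => /orP[/eqP xy|].
    by rewrite -xy in xC *; rewrite xC orbT.
  by move/(subsetP DC); rewrite !inE andbT => ->; rewrite orbT.
have fx : f x = w.
  by have := nzf x; rewrite /fix_at eqxx; case: (f x =P w) => // _; rewrite eqxx.
have Cf : C \subset component f v.
  apply: Cv => y; have := nzf y; rewrite /fix_at.
  by case: (altP (y =P x)) => // ->; rewrite fx.
apply/subsetP => u; rewrite !inE => /orP[/eqP->|/(subsetP Cf)]; last by rewrite inE.
have := subsetP Cf _ xC; rewrite inE => /connect_trans; apply.
by apply: connect1; rewrite -fx; case: {+}x => y b; apply: pick_relE.
Qed.

Definition small_prob (mu : T * bool -> T -> R) v : R :=
  expect mu (fun f => (small lam f v)%:R).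

Lemma small_prob_large mu D C v : explored mu D C v ->
  (lam < 4 * #|C|)%N -> small_prob mu v <= 0.
Proof.
move=> ex lamC; rewrite -[leRHS](expect_cst 0 (explored_sum1 ex)).
apply: le_expect => [|f nz]; first exact: explored_ge0 ex.
rewrite /small leqNgt (leq_trans lamC) // leq_mul2l /=.
exact/subset_leq_card/(explored_component ex).
Qed.

(** Condition on the unrevealed pick [x]. Each vertex is hit with probability at most [1 / lam], so
    the pick lands in [C] with probability at most [#|C| / lam]; the probability of leaving [C] is
    bounded by 1. *)
Lemma small_prob_step mu D C v x (a b : R) : explored mu D C v ->
  x.1 \in C -> x \notin D -> 0 <= a -> 0 <= b ->
  (forall w, w \in C -> mu x w != 0 -> small_prob (fix_at mu x w) v <= a) ->
  (forall w, w \notin C -> mu x w != 0 -> small_prob (fix_at mu x w) v <= b) ->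
  small_prob mu v <= #|C|%:R / lam%:R * a + b.
Proof.
move=> ex xC xD a0 b0 ha hb; rewrite /small_prob (expect_fix _ x).
have lam0 : 0 < lam%:R :> R by rewrite ltr0n.
apply: (@le_trans _ _ (\sum_w ((w \in C)%:R / lam%:R * a + mu x w * b))).
  apply: ler_sum => w _.
  have [->|nz] := eqVneq (mu x w) 0.
    by rewrite !mul0r addr0 mulr_ge0 ?divr_ge0.
  have mu0 := explored_ge0 ex x w.
  case: (boolP (w \in C)) => wC; last first.
    by rewrite !mul0r add0r ler_wpM2l // hb.
  apply: ler_wpDr; first exact: mulr_ge0.
  apply: ler_pM => //.
    rewrite sumr_ge0 // => f _; rewrite mulr_ge0 // prodr_ge0 // => y _.
    by rewrite /fix_at; case: ifP => // _; apply: explored_ge0 ex _ _.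
    rewrite (explored_walk ex) // /walk mul1r ler_pdivrMr ?deg_gt0 //.
    rewrite mulrC ler_pdivlMr // (le_trans (y := lam%:R)) ?ler_nat //.
    by rewrite ler_piMl ?ler0n // lern1; case: (e _ _).
  exact: ha.
rewrite big_split /= -!big_distrl /= (explored_sum1 ex) mul1r lerD2r.
by rewrite -natr_sum -(big_mkcond (mem C)) sum1_card.
Qed.

Lemma exists_unrevealed (D : {set T * bool}) (C : {set T}) : (#|D| < 2 * #|C|)%N ->
  exists2 x, x.1 \in C & x \notin D.
Proof.
move=> DC; have : ~~ (setX C [set: bool] \subset D).
  by apply: contraTN DC => /subset_leq_card; rewrite cardsX cardsT card_bool -leqNgt mulnC.
by case/subsetPn => x; rewrite inE => /andP[xC _] xD; exists x.
Qed.

(** Here [q] counts the unrevealed picks of known vertices: a pick into [C] lowers it by one, a new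
    vertex raises it by one. While [#|C| <= lam / 4] a hit has probability at most 1/4, and
    [1/4 * 2^-(q-1) + 2^-(q+1) = 2^-q] closes the induction on the number of unrevealed picks. *)
Lemma small_prob_exp mu D C v q : explored mu D C v ->
  (#|D| + q = 2 * #|C|)%N -> small_prob mu v <= 2^-1 ^+ q.
Proof.
have [n] := ubnP #|~: D|; elim: n => // n IH in mu D C q *; rewrite ltnS => Dn ex Dq.
have half0 k : 0 <= 2^-1 ^+ k :> R by rewrite exprn_ge0 // invr_ge0.
have [/(small_prob_large ex)/le_trans->//|lamC] := ltnP lam (4 * #|C|).
case: q Dq => [|q] Dq.
  rewrite expr0 -[leRHS](expect_cst 1 (explored_sum1 ex)).
  apply: le_expect => [|f _]; first exact: explored_ge0 ex.
  by rewrite lern1; case: small.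
have [|x xC xD] := @exists_unrevealed D C; first lia.
have DDn : (#|~: (x |: D)| < n)%N.
  apply: leq_trans Dn; apply: proper_card.
  by rewrite properC properE subsetUr subUset sub1set negb_and xD.
have cD : #|x |: D| = #|D|.+1 by rewrite cardsU1 xD.
apply: (@le_trans _ _ (#|C|%:R / lam%:R * 2^-1 ^+ q + 2^-1 ^+ q.+2)).
  apply: (small_prob_step ex xC xD) => // w wC nz.
    have ex' := fix_at_explored ex xC xD nz.
    have wCE : w |: C = C by apply/setUidPr; rewrite sub1set.
    by rewrite wCE in ex'; apply: (IH _ _ _ _ DDn ex'); rewrite cD; lia.
  have := fix_at_explored ex xC xD nz => /IH; apply=> //.
  by rewrite cD cardsU1 wC; lia.
rewrite !exprS.
have : #|C|%:R / lam%:R <= 4^-1 :> R.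
  by rewrite ler_pdivrMr ?ltr0n // ler_pdivlMl // -natrM ler_nat.
have := half0 q; nra.
Qed.

(* [m + 1] known vertices with only [m] revealed picks: no pick so far has hit a
   known vertex, and the first one to do so has probability at most
   [#|C| / lam], which is where the factor [1 / lam] comes from. *)
Lemma small_prob_tree mu D C v m : explored mu D C v ->
  #|D| = m -> #|C| = m.+1 -> small_prob mu v <= m.+2%:R / lam%:R * 2^-1 ^+ m.
Proof.
have [n] := ubnP #|~: D|; elim: n => // n IH in mu D C m *; rewrite ltnS => Dn ex Dm Cm.
have half0 k : 0 <= 2^-1 ^+ k :> R by rewrite exprn_ge0 // invr_ge0.
have [|x xC xD] := @exists_unrevealed D C; first lia.
have DDn : (#|~: (x |: D)| < n)%N.
  apply: leq_trans Dn; apply: proper_card.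
  by rewrite properC properE subsetUr subUset sub1set negb_and xD.
have cD : #|x |: D| = #|D|.+1 by rewrite cardsU1 xD.
(* After a hit, [m.+1] known vertices have [m.+1] revealed picks, so [small_prob_exp] applies with
   [q = m.+1]; a miss recurs with [m.+1]. The terms add up exactly, as [(m+1) + (m+3) = 2(m+2)]. *)
apply: (@le_trans _ _ (#|C|%:R / lam%:R * 2^-1 ^+ m.+1 +
    m.+3%:R / lam%:R * 2^-1 ^+ m.+1)).
  apply: (small_prob_step ex xC xD) => // [|w wC nz|w wC nz].
  - by rewrite mulr_ge0 ?divr_ge0.
  - have ex' := fix_at_explored ex xC xD nz.
    have wCE : w |: C = C by apply/setUidPr; rewrite sub1set.
    by rewrite wCE in ex'; apply: small_prob_exp ex' _; rewrite cD; lia.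
  - apply: (IH _ _ _ m.+1 DDn (fix_at_explored ex xC xD nz)); first by rewrite cD Dm.
    by rewrite cardsU1 wC Cm.
rewrite Cm exprS le_eqVlt; apply/orP; left; apply/eqP.
have : lam%:R != 0 :> R by rewrite pnatr_eq0 -lt0n.
by rewrite -!natr1 => lam0; field.
Qed.

Lemma small_prob_walk v : small_prob walk v <= 2 / lam%:R.
Proof.
have ex : explored walk set0 [set v] v.
  split=> //; [exact: walk_ge0 | exact: sum_walk | exact: sub0set |].
  by move=> f _; rewrite sub1set inE connect0.
by have := small_prob_tree ex (cards0 _) (cards1 _); rewrite expr0 mulr1.
Qed.

Lemma expect_ncomponents :
  lam%:R * expect walk (fun f => (ncomponents f)%:R) <= 6 * #|T|%:R.
Proof.
have lam0 : 0 < lam%:R :> R by rewrite ltr0n.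
rewrite -expectZ; apply: (@le_trans _ _ (expect walk (fun f =>
    4 * #|T|%:R + lam%:R * \sum_v (small lam f v)%:R))).
  apply: le_expect => [|f _]; first exact: walk_ge0.
  by rewrite -natr_sum -!natrM -natrD ler_nat ncomponents_bound.
rewrite expectD (expect_cst _ sum_walk) expectZ expect_sum.
have : lam%:R * (\sum_v small_prob walk v) <= 2 * #|T|%:R.
  rewrite mulr_natr -sumr_const big_distrr /=; apply: ler_sum => v _.
  by rewrite mulrC -ler_pdivlMr // small_prob_walk.
by rewrite /small_prob; lra.
Qed.

End RandomContraction.

(** * Counting cut edges, and two rank arguments *)

Section Cuts.
Set Implicit Arguments. Unset Strict Implicit.
Variables (T : finType) (e : rel T) (e_sym : symmetric e) (e_irr : irreflexive e).
Implicit Types (X : {set T}) (u v w : T).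

Definition crossing X v : nat := #|[set u | e v u & (u \in X) != (v \in X)]|.

Lemma card_set2I X u w : u != w ->
  (#|[set u; w] :&: X| == 1%N) = ((u \in X) != (w \in X)).
Proof.
have set1IX v : [set v] :&: X = if v \in X then [set v] else set0.
  by case: ifP => vX; apply/setP => y; rewrite !inE; case: eqP => // ->; rewrite vX.
move=> uw; rewrite setIUl !set1IX.
by do 2!case: ifP => _; rewrite ?set0U ?setU0 ?cards1 ?cards0 ?cards2 ?uw.
Qed.

Lemma edgeP s : reflect (exists u w, e u w /\ s = [set u; w]) (s \in edges e).
Proof.
rewrite inE; apply: (iffP existsP) => -[u].
  by case/existsP => w /andP[uw /eqP->]; exists u, w.
by case=> w [uw ->]; exists u; apply/existsP; exists w; rewrite uw eqxx.
Qed.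

Lemma edge_neq u w : e u w -> u != w.
Proof. by apply: contraTneq => ->; rewrite e_irr. Qed.

Lemma cutP X s :
  reflect (exists u w, [/\ e u w, u \in X, w \notin X & s = [set u; w]])
          (s \in cut e X).
Proof.
rewrite inE; apply: (iffP andP) => [[/edgeP[u [w [uw ->]]]]|[u [w [uw uX wX ->]]]].
  rewrite card_set2I ?edge_neq // => /eqP; case: (boolP (u \in X)) => uX.
    by case: (boolP (w \in X)) => wX // _; exists u, w.
  by case: (boolP (w \in X)) => wX // _; exists w, u; rewrite e_sym setUC.
split; first by apply/edgeP; exists u, w.
by rewrite card_set2I ?edge_neq // uX (negbTE wX).
Qed.

Lemma cutC X : cut e (~: X) = cut e X.
Proof.
apply/setP => s; apply/cutP/cutP => -[u [w]]; rewrite ?inE ?negbK.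
  by move=> [uw uX wX ->]; exists w, u; rewrite e_sym setUC.
by move=> [uw uX wX ->]; exists w, u; rewrite !inE negbK e_sym setUC.
Qed.

Lemma card_cut X : #|cut e X| = (\sum_(v in X) crossing X v)%N.
Proof.
(* Orienting each cut edge out of [X] makes it a unique ordered pair. *)
pose P := [set p : T * T | [&& e p.1 p.2, p.1 \in X & p.2 \notin X]].
have -> : cut e X = [set [set p.1; p.2] | p in P].
  apply/setP => s; apply/cutP/imsetP => [[u [w [uw uX wX ->]]]|[[u w]]].
    by exists (u, w); rewrite // inE uw uX.
  by rewrite inE => /and3P[/= uw uX wX] ->; exists u, w.
rewrite card_in_imset => [|[u w] [u' w']]; last first.
  rewrite !inE /= => /and3P[uw uX wX] /and3P[uw' uX' wX'] /setP eq2.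
  have := eq2 u; have := eq2 w; rewrite !inE !eqxx orbT /= => /esym w2 /esym u2.
  case/orP: u2 => /eqP uE; last by rewrite -uE uX in wX'.
  by case/orP: w2 => /eqP wE; [rewrite wE uX' in wX | rewrite uE wE].
rewrite -sum1_card big_mkcond /= (eq_bigr (fun p => (p.1, p.2) \in P : nat)); last first.
  by case=> u w _ /=; case: ifP.
rewrite -(pair_bigA _ (fun u w => ((u, w) \in P) : nat)) /= [RHS]big_mkcond /=.
apply: eq_bigr => v _; rewrite /crossing; case: ifP => vX.
  rewrite -sum1_card [RHS]big_mkcond /=; apply: eq_bigr => u _.
  by rewrite !inE /= vX /=; case: (u \in X); rewrite /= ?andbF ?andbT //; case: (e v u).
by rewrite big1 // => u _; rewrite inE /= vX andbF.
Qed.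

Lemma sum_crossing X : (\sum_v crossing X v = 2 * #|cut e X|)%N.
Proof.
rewrite (bigID (mem X)) /= mul2n -addnn {1}card_cut -cutC card_cut.
congr addn; apply: eq_big => v; rewrite ?inE // => vX.
by apply: eq_card => u; rewrite !inE; do 2!case: (_ \in X).
Qed.

Lemma crossing_le_deg X v : (crossing X v <= deg e v)%N.
Proof. by apply/subset_leq_card/subsetP => u; rewrite !inE => /andP[]. Qed.

(** Removing [v] from [X] trades its [crossing X v] cut edges for its other [deg e v - crossing X v]
    edges. *)
Lemma cut_setD1 X v : v \in X ->
  (#|cut e (X :\ v)| + 2 * crossing X v = #|cut e X| + deg e v)%N.
Proof.
move=> vX; rewrite !card_cut [X in (_ = X + _)%N](bigD1 v) //=.
have -> : (\sum_(w in X :\ v) crossing (X :\ v) w =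
           \sum_(w in X | w != v) (crossing X w + e v w))%N.
  apply: eq_big => [w|w]; first by rewrite !inE andbC.
  rewrite !inE => /andP[wv wX]; rewrite /crossing -!sum1_card.
  rewrite [LHS]big_mkcond [X in _ = (X + _)%N]big_mkcond /=.
  have -> : nat_of_bool (e v w) = (\sum_u if u == v then nat_of_bool (e v w) else 0)%N.
    by rewrite -big_mkcond big_pred1_eq.
  rewrite -big_split /=; apply: eq_bigr => u _; rewrite !inE wv wX /= e_sym.
  case: (altP (u =P v)) => [->|_] /=; last by rewrite addn0 e_sym.
  by rewrite vX andbF andbT; case: (e v w).
have -> : (deg e v = crossing X v + \sum_(w in X | w != v) e v w)%N.
  rewrite /deg /crossing -!sum1_card (bigID (mem X)) /= addnC; congr addn.
    by apply: eq_bigl => u; rewrite !inE vX; case: (u \in X).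
  rewrite big_mkcond [RHS]big_mkcond; apply: eq_bigr => u _; rewrite !inE.
  case: (altP (u =P v)) => [->|_]; rewrite ?e_irr ?vX //=.
  by rewrite andbT; case: (e v u); case: (u \in X).
by rewrite big_split /=; lia.
Qed.

Lemma mincut_le X : proper_nonempty X -> (mincut e <= #|cut e X|)%N.
Proof.
rewrite /mincut; move: (mem_index_enum X); elim: index_enum => // Y r IH.
rewrite inE big_cons => /orP[/eqP<- ->|Xr pX]; first exact: geq_minl.
by case: ifP => _; rewrite ?geq_min ?IH ?orbT.
Qed.

Lemma proper_nonemptyD1 X v : v \in X -> (1 < #|X|)%N ->
  proper_nonempty (X :\ v).
Proof.
move=> vX X1; apply/andP; split; first by rewrite -card_gt0; move: X1; rewrite (cardsD1 v X) vX.
by apply/eqP => /setP/(_ v); rewrite !inE eqxx.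
Qed.

Lemma mincut_le_deg v : (1 < #|T|)%N -> (mincut e <= deg e v)%N.
Proof.
move=> T1; apply: leq_trans (mincut_le (X := [set v]) _) _.
  apply/andP; split; first by apply/set0Pn; exists v; rewrite inE.
  by apply: contraTneq T1 => vT; rewrite -cardsT -vT cards1.
by rewrite card_cut big_set1 crossing_le_deg.
Qed.

(* The cuts separating a pair of points are determined by the 0/1 rows of the
   [X] in [Fam]; a subset of rows of full rank therefore separates the same
   pairs, and the rank is at most the number of classes. *)
Lemma cut_basis (rho : T -> T) (D : {set T}) (Fam : {set {set T}}) :
  (forall v, rho v \in D) ->
  (forall X, X \in Fam -> forall v, (rho v \in X) = (v \in X)) ->
  exists G : {set {set T}}, [/\ G \subset Fam, (#|G| <= #|D|)%N &
    \bigcup_(X in Fam) cut e X = \bigcup_(X in G) cut e X].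
Proof.
move=> rhoD sat.
pose X_ (i : 'I_#|Fam|) : {set T} := enum_val i.
pose v_ (j : 'I_#|T|) : T := enum_val j.
pose d_ (j : 'I_#|D|) : T := enum_val j.
pose A : 'M[rat]_(#|Fam|, #|T|) := \matrix_(i, j) (v_ j \in X_ i)%:R.
have rA : (\rank A <= #|D|)%N.
  (* The columns of [v] and [rho v] agree, so [A] factors through the columns indexed by [D]. *)
  have -> : A = (\matrix_(i, j) (d_ j \in X_ i)%:R) *m
      (\matrix_(i, j) (d_ i == rho (v_ j))%:R).
    apply/matrixP => i j; rewrite !mxE.
    under eq_bigr do rewrite !mxE.
    rewrite -(big_enum_val (A := mem D) (fun d => (d \in X_ i)%:R * (d == rho (v_ j))%:R)).
    rewrite (bigD1 (rho (v_ j))) //= eqxx mulr1 big1 ?addr0.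
      by rewrite sat ?enum_valP.
    by move=> d /andP[_ /negbTE->]; rewrite mulr0.
  exact: mulmx_max_rank.
pose g := maxrankfun A.
exists [set enum_val (g k) | k : 'I_(\rank A)]; split.
- by apply/subsetP => _ /imsetP[k _ ->]; apply: enum_valP.
- by apply: leq_trans rA; rewrite (leq_trans (leq_imset_card _ _)) ?card_ord.
apply/eqP; rewrite eqEsubset; apply/andP; split; last first.
  apply/bigcupsP => _ /imsetP[k _ ->].
  by apply: bigcup_sup; apply: enum_valP.
apply/bigcupsP => X XF; apply/subsetP => s /cutP[u [w [uw uX wX sE]]].
apply: contraT => sG.
(* If no chosen set separates [u] from [w], their columns agree on the chosen rows, hence on all
   rows of [A], which these span; but the row of [X] separates them. *)
have eqg k : (u \in enum_val (g k)) = (w \in enum_val (g k)).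
  apply: contraNeq sG => neq; apply/bigcupP; exists (enum_val (g k)).
    exact: imset_f.
  by rewrite inE sE card_set2I ?edge_neq // neq andbT; apply/edgeP; exists u, w.
have /submxP[M AE] : (A <= rowsub g A)%MS by rewrite eq_maxrowsub.
have AX v : A (enum_rank_in XF X) (enum_rank v) = (v \in X)%:R.
  by rewrite mxE /X_ /v_ enum_rankK enum_rankK_in.
have : (u \in X)%:R = (w \in X)%:R :> rat.
  rewrite -!AX AE !mxE; apply: eq_bigr => k _.
  by rewrite !mxE /v_ !enum_rankK eqg.
by rewrite uX (negbTE wX) => /eqP; rewrite oner_eq0.
Qed.

(** All rows of the matrix lie in the span of the [#|T|] star vectors and the [#|H|] unit vectors of
    the edges in [H]. *)
Lemma cdim_le (R : realType) (alpha : R) (H : {set {set T}}) :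
  (forall S, S \in near_mincuts e alpha ->
     (exists v, S = cut e [set v]) \/ S \subset H) ->
  (cdim e alpha <= #|T| + #|H|)%N.
Proof.
move=> SH; rewrite /cdim; set M := near_mincut_matrix _ _.
pose v_ (i : 'I_#|T|) : T := enum_val i.
pose h_ (i : 'I_#|H|) : {set T} := enum_val i.
pose s_ (j : 'I_#|edges e|) : {set T} := enum_val j.
pose stars : 'M[R]_(_, _) := \matrix_(i, j) (s_ j \in cut e [set v_ i])%:R.
pose units : 'M[R]_(_, _) := \matrix_(i, j) (h_ i == s_ j)%:R.
pose B : 'M[R]_(#|T| + #|H|, #|edges e|) := col_mx stars units.
suff /mxrankS/leq_trans : (M <= B)%MS by apply; apply: rank_leq_row.
apply/row_subP => i.
have [[v Sv]|SsubH] := SH _ (enum_valP i).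
  apply: submx_trans (row_sub (lshift _ (enum_rank v)) B).
  rewrite /B rowKu; apply: (@eq_row_sub _ _ _ _ _ ord0).
  by apply/rowP => j; rewrite !mxE Sv /v_ enum_rankK.
have uB : (units <= B)%MS by apply/row_subP => k; rewrite -(rowKd k stars) row_sub.
apply: submx_trans uB; apply/submxP.
exists (\row_h (h_ h \in (enum_val i : {set {set T}}))%:R).
apply/rowP => j; rewrite !mxE; under eq_bigr do rewrite !mxE.
rewrite -(big_enum_val (A := mem H) (fun s => (s \in enum_val i)%:R * (s == s_ j)%:R)).
have [jH|jH] := boolP (s_ j \in H).
  rewrite (bigD1 (s_ j)) //= eqxx mulr1 big1 ?addr0 //.
  by move=> s /andP[_ /negbTE->]; rewrite mulr0.
rewrite (contraNF (subsetP SsubH _) jH) big1 // => s sH.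
by case: eqP => [sj|_]; rewrite ?mulr0 // -sj sH in jH *.
Qed.

End Cuts.

(** * Survival of the cuts with at least two vertices on both sides *)

Section NearMincuts.
Set Implicit Arguments. Unset Strict Implicit.
Variables (R : realType) (T : finType) (e : rel T).
Variables (e_sym : symmetric e) (e_irr : irreflexive e).
Variables (alpha : R) (alpha_ge1 : 1 <= alpha) (alpha_lt2 : alpha < 2).
Implicit Types (X : {set T}) (v : T).

(** With two vertices on each side, moving any one vertex across still leaves a proper cut. *)
Definition thick_cuts : {set {set T}} :=
  [set X : {set T} | [&& (1 < #|X|)%N, (1 < #|~: X|)%N &
     #|cut e X|%:R <= alpha * (mincut e)%:R]].

Lemma thick_cutsC X : (~: X \in thick_cuts) = (X \in thick_cuts).
Proof. by rewrite !inE setCK cutC // andbCA. Qed.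

Lemma thick_card X : X \in thick_cuts -> (1 < #|T|)%N.
Proof. by rewrite inE => /and3P[X1 _ _]; apply: leq_trans X1 (max_card _). Qed.

(* Moving [v] to the other side of a thick cut leaves a cut of weight at least
   [mincut e], hence [2 * crossing X v <= (alpha - 1) * mincut e + deg e v]. *)
Lemma crossing_thick X v : X \in thick_cuts ->
  (crossing e X v)%:R <= alpha / 2 * (deg e v)%:R.
Proof.
wlog vX : X / v \in X => [H XN|].
  have [|vX] := boolP (v \in X); first by move/H; apply.
  have <- : crossing e (~: X) v = crossing e X v.
    by apply: eq_card => u; rewrite !inE; do 2!case: (_ \in X).
  by apply: H; rewrite ?thick_cutsC // inE.
move=> XN; have degv := mincut_le_deg e_sym e_irr v (thick_card XN).
move: XN; rewrite inE => /and3P[X1 _ cutX].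
have := mincut_le e (proper_nonemptyD1 vX X1).
rewrite -(ler_nat R) => cutY.
have : #|cut e (X :\ v)|%:R + 2 * (crossing e X v)%:R
    = #|cut e X|%:R + (deg e v)%:R :> R.
  by rewrite -natrM -!natrD cut_setD1.
(* This turns the bound [(alpha - 1) * mincut e + deg e v] into [alpha * deg e v]. *)
have : (alpha - 1) * (mincut e)%:R <= (alpha - 1) * (deg e v)%:R.
  by rewrite ler_wpM2l ?subr_ge0 ?ler_nat.
lra.
Qed.

Lemma thick_deg_ge X v : X \in thick_cuts -> (mincut e <= deg e v)%N.
Proof. by move/thick_card/(mincut_le_deg e_sym e_irr). Qed.

Definition respects (f : {ffun T * bool -> T}) X : bool :=
  [forall x, (f x \in X) == (x.1 \in X)].

Lemma respects_root f X v : respects f X ->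
  (fingraph.root (pick_rel f) v \in X) = (v \in X).
Proof.
move=> /forallP fX; apply/esym/(closed_connect _ (connect_root _ v)).
move=> u w /existsP[b /orP[/eqP<-|/eqP<-]]; first by rewrite (eqP (fX _)).
by rewrite (eqP (fX _)).
Qed.

(** The 8 bounds the sum, over all picks, of the probability of crossing [X]: each of the two picks
    per vertex contributes at most [2 * alpha <= 4] in total. The denominator comes from [expR_le1B]
    with [b = 1 - alpha / 2]. *)
Definition respect_prob : R := sequences.expR (- (8 / (1 - alpha / 2))).

(** Since [expR (y / b) >= 1 + y / b], it suffices that [(1 + y / b) * (1 - y) >= 1]. *)
Lemma expR_le1B (b y : R) : 0 < b -> 0 <= y -> y <= 1 - b ->
  sequences.expR (- (y / b)) <= 1 - y.
Proof.
move=> b0 y0 yb; rewrite exp.expRN.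
have y1 : 0 < 1 - y by lra.
rewrite -[leRHS]invrK lef_pV2 ?posrE ?invr_gt0 ?exp.expR_gt0 //.
apply: le_trans (exp.expR_ge1Dx _); rewrite -div1r ler_pdivrMr //.
have -> : (1 + y / b) * (1 - y) = 1 + y / b * (1 - b - y).
  by field; rewrite gt_eqF.
by rewrite lerDl mulr_ge0 ?subr_ge0 // divr_ge0 // ltW.
Qed.

Lemma expect_respects X : X \in thick_cuts -> (0 < mincut e)%N ->
  respect_prob <= expect (walk R e) (fun f => (respects f X)%:R).
Proof.
move=> XN lam0; have b0 : 0 < 1 - alpha / 2 by rewrite subr_gt0 ltr_pdivrMr // mul1r.
have dge v := thick_deg_ge v XN.
have lamR : 0 < (mincut e)%:R :> R by rewrite ltr0n.
have d0 v : 0 < (deg e v)%:R :> R by rewrite ltr0n; apply: leq_trans (dge v).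
pose y v : R := (crossing e X v)%:R / (deg e v)%:R.
(* The picks are independent, and one by [v] crosses [X] with probability [y v]. *)
have -> : expect (walk R e) (fun f => (respects f X)%:R) =
    \prod_(x : T * bool) (1 - y x.1).
  transitivity (expect (walk R e) (fun f =>
      \prod_(x : T * bool) ((f x \in X) == (x.1 \in X))%:R)).
    apply: eq_bigr => f _; congr (_ * _).
    have [/forallP fX|] := boolP (respects f X).
      by rewrite big1 // => x _; rewrite fX.
    by rewrite negb_forall => /existsP[x /negbTE fx]; rewrite (bigD1 x) //= fx mul0r.
  rewrite (expect_prod _ (fun (x : T * bool) u => ((u \in X) == (x.1 \in X))%:R)).
  apply: eq_bigr => x _; rewrite -[X in _ = X - _](sum_walk R lam0 dge x).
  apply/eqP.
  rewrite eq_sym subr_eq /y /crossing -sum1_card natr_sum [X in _ + X / _]big_mkcond /=.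
  rewrite big_distrl -big_split /=; apply/eqP/eq_bigr => u _ /=.
  rewrite /walk inE -mulrA [_^-1 * _]mulrC mulrA -mulrDl; congr (_ / _).
  by case: (e _ _); case: eqP; rewrite ?(mulr1, mulr0, addr0, add0r).
apply: (@le_trans _ _ (\prod_(x : T * bool) sequences.expR (- (y x.1 / (1 - alpha / 2))))).
  rewrite -exp.expR_sum exp.ler_expR sumrN lerN2 -big_distrl /=.
  rewrite ler_pM2r ?invr_gt0 //.
  rewrite -(pair_bigA _ (fun v _ => y v)) /=.
  under eq_bigr do rewrite sumr_const card_bool.
  rewrite sumrMnl -mulr_natr.
  (* Bounding degrees below by [mincut e], the sum is at most
     [2 * #|cut e X| / mincut e <= 2 * alpha]. *)
  have : \sum_v y v <= 4.
    apply: (@le_trans _ _ (\sum_v (crossing e X v)%:R / (mincut e)%:R)).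
      by apply: ler_sum => v _; rewrite ler_wpM2l // lef_pV2 ?posrE ?ler_nat.
    rewrite -big_distrl -natr_sum sum_crossing //= ler_pdivrMr // natrM.
    by move: XN; rewrite inE => /and3P[_ _]; nra.
  by lra.
apply: ler_prod => x _; rewrite exp.expR_ge0 /= expR_le1B ?divr_ge0 //.
by rewrite ler_pdivrMr // opprB addrC subrK crossing_thick.
Qed.

Definition thick_edges : {set {set T}} := \bigcup_(X in thick_cuts) cut e X.

Definition kept_edges f : {set {set T}} :=
  \bigcup_(X in [set X in thick_cuts | respects f X]) cut e X.

(** A set respected by [f] is a union of components, so [cut_basis] with component roots as
    representatives covers the kept edges by [ncomponents f] cuts or fewer. *)
Lemma card_kept_edges f :
  #|kept_edges f|%:R <= alpha * (mincut e)%:R * (ncomponents f)%:R :> R.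
Proof.
rewrite /kept_edges.
have [v|X|G [GF cG ->]] := @cut_basis T e e_sym e_irr
  (fingraph.root (pick_rel f))
  [set v | roots (pick_rel f) v] [set X in thick_cuts | respects f X].
- by rewrite inE roots_root //; apply: pick_connect_sym.
- by rewrite inE => /andP[_ fX] v; apply: respects_root.
apply: (@le_trans _ _ (\sum_(X in G) #|cut e X|%:R)).
  rewrite -natr_sum ler_nat.
  by apply: (big_ind2 (fun (A : {set {set T}}) n => (#|A| <= n)%N)) => [|A m B n Am Bn|//];
    [rewrite cards0 | apply: leq_trans (leq_card_setU _ _) (leq_add Am Bn)].
apply: (@le_trans _ _ (\sum_(X in G) alpha * (mincut e)%:R)).
  apply: ler_sum => X /(subsetP GF); rewrite !inE.
  by case/andP => /and3P[_ _ ->].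
rewrite sumr_const -[leLHS]mulr_natr ler_wpM2l ?ler_nat // mulr_ge0 //.
exact: le_trans ler01 alpha_ge1.
Qed.

(** Double counting of the expected number of kept edges: each thick edge is kept with probability
    at least [respect_prob], while the expectation is at most [alpha * 6 * #|T| <= 12 * #|T|]. *)
Lemma card_thick_edges : #|thick_edges|%:R <= 12 / respect_prob * #|T|%:R.
Proof.
have alpha12 : alpha * 6 <= 12 by have := alpha_lt2; lra.
have p0 : 0 < respect_prob by apply: exp.expR_gt0.
have c0 : 0 <= 12 / respect_prob * #|T|%:R by rewrite mulr_ge0 // divr_ge0 // ltW.
have [N0|[X0 X0N]] := set_0Vmem thick_cuts.
  by rewrite /thick_edges N0 big_set0 cards0.
(* When the minimum cut is 0, thick cuts have no edges; otherwise degrees are positive and [walk] is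
   a probability. *)
have [lam0|lam0] := posnP (mincut e).
  rewrite /thick_edges big1 ?cards0 // => X.
  by rewrite inE lam0 mulr0 lern0 => /and3P[_ _ /eqP/cards0_eq].
have dge v := thick_deg_ge v X0N.
rewrite -mulrAC ler_pdivlMr // mulrC.
apply: (@le_trans _ _ (expect (walk R e) (fun f => #|kept_edges f|%:R))).
  have -> : expect (walk R e) (fun f => #|kept_edges f|%:R) =
      \sum_s expect (walk R e) (fun f => (s \in kept_edges f)%:R).
    rewrite -expect_sum; apply: eq_bigr => f _; congr (_ * _).
    by rewrite -natr_sum -sum1_card big_mkcond.
  rewrite mulr_natr -sumr_const [X in X <= _]big_mkcond; apply: ler_sum => s _.
  case: ifP => [/bigcupP[X XN sX]|_].
    apply: le_trans (expect_respects XN lam0) _.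
    apply: le_expect => [|f _]; first exact: walk_ge0.
    case: (boolP (respects f X)) => // fX; rewrite ler_nat lt0b.
    by apply/bigcupP; exists X; rewrite // inE XN.
  by rewrite sumr_ge0 // => f _; rewrite mulr_ge0 ?prodr_ge0 // => x _; apply: walk_ge0.
apply: (@le_trans _ _ (alpha * ((mincut e)%:R *
    expect (walk R e) (fun f => (ncomponents f)%:R)))).
  rewrite mulrA -expectZ; apply: le_expect => [|f _]; first exact: walk_ge0.
  exact: card_kept_edges.
apply: le_trans (ler_wpM2l (le_trans ler01 alpha_ge1) (expect_ncomponents R lam0 dge)) _.
by rewrite mulrA ler_wpM2r.
Qed.

Lemma near_mincut_cases S : S \in near_mincuts e alpha ->
  (exists v, S = cut e [set v]) \/ S \subset thick_edges.
Proof.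
rewrite inE => /andP[/existsP[X /andP[/andP[X0 XT] /eqP->]] cX].
have [X1|X1] := leqP #|X| 1.
  left; have /cards1P[v ->] : #|X| == 1%N by rewrite eqn_leq X1 card_gt0.
  by exists v.
have [X1'|X1'] := leqP #|~: X| 1.
  left; have /cards1P[v vE] : #|~: X| == 1%N.
    rewrite eqn_leq X1' card_gt0; apply: contra XT => /eqP XC.
    by rewrite -(setCK X) XC setC0.
  by exists v; rewrite -vE cutC.
by right; apply: bigcup_sup; rewrite inE X1 X1'.
Qed.

Lemma cdim_bound : (cdim e alpha)%:R <= (1 + 12 / respect_prob) * #|T|%:R.
Proof.
rewrite mulrDl mul1r; apply: le_trans (lerD (lexx _) card_thick_edges).
by rewrite -natrD ler_nat cdim_le //; apply: near_mincut_cases.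
Qed.

End NearMincuts.

Theorem theorem18 (R : realType) (alpha : R) :
  1 <= alpha -> alpha < 2 ->
  exists C : R, forall (T : finType) (e : rel T),
    symmetric e -> irreflexive e ->
    ((cdim e alpha)%:R : R) <= C * (#|T|%:R).
Proof.
move=> alpha1 alpha2; exists (1 + 12 / respect_prob alpha) => T e e_sym e_irr.
exact: cdim_bound.
Qed.
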